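(* The second-order partial differential equation $$u_{tt}+a(x,t)u_{xt}+b(t)u_{t}=\alpha(x,t)+G(u)\,\bigl(u_{t}+a(x,t)u_{x}\bigr)e^{-\int b(t)\,dt}$$ can be reduced to the first-order differential equation $$u_{t}(x,t)=\bigl(H(t)+K(u)\bigr)e^{-\int b(t)\,dt},$$ where the functions $H$ and $K$ are the general solutions of $$H'(t)=\alpha(x(t),t)\,e^{\int b(t)\,dt}\qquad\text{and}\qquad K'(u)=G(u).$$
   Context: Here $u$ is an unknown function of $(x,t)\in\mathbb{R}^2$, subscripts denote partial derivatives, and $a(x,t)$, $\alpha(x,t)$, $b(t)$, $G(u)$ are given functions. The curve $x(t)$ is the solution of the characteristic equation $\frac{d}{dt}x(t)=a(x(t),t)$, $x(0)=x_0$. $H$ and $K$ are differentiable functions of $t$ and of $u$ respectively. The reduction is obtained by rewriting the equation along $x=x(t)$ and assuming that $u_t$ has the form $u_t=(H(t)+K(u))e^{-\int b(t)\,dt}$. *)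

(* Defs.v *)
From Stdlib Require Import Reals.
From Coquelicot Require Import Coquelicot.
Open Scope R_scope.

(* Functions of (x,t) are curried, with x first. *)
Definition Dx (f : R -> R -> R) (x t : R) : R := Derive (fun y => f y t) x.
Definition Dt (f : R -> R -> R) (x t : R) : R := Derive (fun s => f x s) t.

(* [Derive] is total, so the partial derivatives of [f] are meaningful only
   together with this regularity: [ex_diff_n f 2 x t] asks for existence and
   continuity at (x,t) of all partial derivatives of order at most two. *)
Definition of_class_C2 (f : R -> R -> R) : Prop := forall x t, ex_diff_n f 2 x t.

(* B is the chosen indefinite integral of b. *)
Definition pde_at (a alpha : R -> R -> R) (b B G : R -> R)
    (u : R -> R -> R) (x t : R) : Prop :=
  Dt (Dt u) x t + a x t * Dt (Dx u) x t + b t * Dt u x t =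
  alpha x t + G (u x t) * (Dt u x t + a x t * Dx u x t) * exp (- B t).

Definition between (lo hi : Rbar) (t : R) : Prop :=
  Rbar_lt lo t /\ Rbar_lt t hi.

(* Characteristics may blow up in finite time, hence the interval of
   existence ]lo, hi[ around the initial time. *)
Definition characteristic (a : R -> R -> R) (lo hi : Rbar) (x0 : R)
    (x : R -> R) : Prop :=
  between lo hi 0 /\ x 0 = x0 /\
  forall t, between lo hi t -> is_derive x t (a (x t) t).

Definition first_order_along (B K : R -> R) (lo hi : Rbar) (x H : R -> R)
    (u : R -> R -> R) : Prop :=
  forall t, between lo hi t ->
    Dt u (x t) t = (H t + K (u (x t) t)) * exp (- B t).

(* The first-order equation holds along the curve for some member H of the
   general solution of H' = alpha(x(t),t) e^B; its integration constant may
   depend on the curve. *)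
Definition reduced_along (alpha : R -> R -> R) (B K : R -> R) (lo hi : Rbar)
    (x : R -> R) (u : R -> R -> R) : Prop :=
  exists H : R -> R,
    (forall t, between lo hi t ->
       is_derive H t (alpha (x t) t * exp (B t))) /\
    first_order_along B K lo hi x H u.

(* Main.v *)
(** Along a characteristic, the chain rule and Schwarz's theorem give
    [(u_t e^B - K(u))' = e^B (u_tt + a u_xt + b u_t - G(u) (u_t + a u_x) e^-B)],
    so the equation says exactly that this derivative is [alpha e^B], and
    [H] has no choice but to be [u_t e^B - K(u)]. *)
From Stdlib Require Import Reals Lra.
From Coquelicot Require Import Coquelicot.
Require Import Defs.
Open Scope R_scope.

(** An x-partial that exists nearby and is continuous at the point, together with a t-partial at the
    point, gives total differentiability; the chain rule for [s => (x s, s)] then applies. *)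
Lemma is_derive_along_curve (f : R -> R -> R) (x : R -> R) (dx t : R)
  (hf : forall p s, ex_diff_n f 1 p s) (hx : is_derive x t dx) :
  is_derive (fun s => f (x s) s) t (Dx f (x t) t * dx + Dt f (x t) t).
Proof.
assert (hd : differentiable_pt_lim f (x t) t (Dx f (x t) t) (Dt f (x t) t)).
{ apply filterdiff_differentiable_pt_lim.
  apply (is_derive_filterdiff f (x t) t (Dx f)).
  - apply filter_forall; intros [p s].
    apply Derive_correct, (hf p s).
  - apply Derive_correct, (hf (x t) t).
  - apply (continuity_2d_pt_filterlim (Dx f)), (hf (x t) t). }
(* The factor 1 is the derivative of the second component [s => s]. *)
replace (Dx f (x t) t * dx + Dt f (x t) t)
  with (Dx f (x t) t * dx + Dt f (x t) t * 1) by ring.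
apply is_derive_Reals, (derivable_pt_lim_comp_2d f x (fun s => s)).
- exact hd.
- apply is_derive_Reals, hx.
- apply derivable_pt_lim_id.
Qed.

(** Differentiating [Dt u] along a curve produces [Dx (Dt u)], whereas the equation contains
    [Dt (Dx u)]. *)
Lemma Dx_Dt_comm (u : R -> R -> R) (hu : of_class_C2 u) (p s : R) :
  Dx (Dt u) p s = Dt (Dx u) p s.
Proof.
apply (Schwarz u).
(* Any radius would do, since the regularity of [u] is global. *)
- exists (mkposreal 1 Rlt_0_1); intros q r _ _.
  destruct (hu q r) as (_ & h1 & h2 & (_ & _ & h3 & _) & (_ & h4 & _)).
  repeat split; assumption.
- apply (hu p s).
- apply (hu p s).
Qed.

Lemma locally_between (lo hi : Rbar) (t : R) :
  between lo hi t -> locally t (between lo hi).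
Proof.
intros [h1 h2]; apply filter_and.
- now apply (open_Rbar_gt lo).
- now apply (open_Rbar_lt hi).
Qed.

Lemma is_derive_first_integral (a : R -> R -> R) (b B G K : R -> R)
  (u : R -> R -> R) (x : R -> R) (t : R)
  (hB : is_derive B t (b t))
  (hK : is_derive K (u (x t) t) (G (u (x t) t)))
  (hu : of_class_C2 u) (hx : is_derive x t (a (x t) t)) :
  is_derive (fun s => Dt u (x s) s * exp (B s) - K (u (x s) s)) t
    ((Dt (Dt u) (x t) t + a (x t) t * Dt (Dx u) (x t) t + b t * Dt u (x t) t
      - G (u (x t) t) * (Dt u (x t) t + a (x t) t * Dx u (x t) t)
        * exp (- B t)) * exp (B t)).
Proof.
assert (hu1 := is_derive_along_curve u x _ t
  (fun p s => ex_diff_n_m 2 1 (le_S _ _ (le_n 1)) u p s (hu p s)) hx).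
assert (hu2 := is_derive_along_curve (Dt u) x _ t
  (fun p s => ex_diff_n_deriv_aux2 u 1 p s (hu p s)) hx).
rewrite (Dx_Dt_comm u hu) in hu2.
assert (hE : exp (- B t) * exp (B t) = 1)
  by (rewrite <- exp_plus, Rplus_opp_l; apply exp_0).
evar_last.
- apply (is_derive_minus (K := R_AbsRing) (V := R_NormedModule)).
  + apply (is_derive_mult (fun s => Dt u (x s) s) (fun s => exp (B s))).
    * exact hu2.
    * apply (is_derive_comp exp B); [apply is_derive_exp | exact hB].
    * exact Rmult_comm.
  + apply (is_derive_comp K (fun s => u (x s) s)); [exact hK | exact hu1].
- unfold minus, plus, opp, scal, mult; simpl; unfold mult; simpl.
  (* The derivative of the [K] term has no exponential: the factors [exp (- B t)] and [exp (B t)]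
     cancel there. *)
  rewrite Rmult_minus_distr_r, (Rmult_assoc _ (exp (- B t))), hE.
  ring.
Qed.

Lemma pde_along_iff_reduced (a alpha : R -> R -> R) (b B G K : R -> R)
  (u : R -> R -> R) (lo hi : Rbar) (x0 : R) (x : R -> R)
  (hB : forall t, is_derive B t (b t))
  (hK : forall v, is_derive K v (G v))
  (hu : of_class_C2 u)
  (hx : characteristic a lo hi x0 x) :
  (forall t, between lo hi t -> pde_at a alpha b B G u (x t) t) <->
  reduced_along alpha B K lo hi x u.
Proof.
destruct hx as (_ & _ & hx).
assert (hE : forall t, exp (- B t) * exp (B t) = 1)
  by (intros t; rewrite <- exp_plus, Rplus_opp_l; apply exp_0).
assert (hW := fun t ht => is_derive_first_integral a b B G K u x t
  (hB t) (hK _) hu (hx t ht)).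
split.
- intros hpde.
  exists (fun s => Dt u (x s) s * exp (B s) - K (u (x s) s)); split.
  + intros t ht; evar_last; [exact (hW t ht) |].
    rewrite (hpde t ht); ring.
  (* For this [H] the first-order equation is an algebraic identity. *)
  + intros t _.
    transitivity (Dt u (x t) t * (exp (- B t) * exp (B t)));
      [rewrite hE |]; ring.
- intros [H [hH hfirst]] t ht.
  assert (hHW : is_derive (fun s => Dt u (x s) s * exp (B s) - K (u (x s) s)) t
    (alpha (x t) t * exp (B t))).
  (* The first-order equation identifies [H] with the first integral on the interval, which is open,
     so their derivatives agree there. *)
  { apply (is_derive_ext_loc H); [| exact (hH t ht)].
    generalize (locally_between lo hi t ht); apply filter_imp.
    intros s hs; rewrite (hfirst s hs), Rmult_assoc, hE; simpl; ring. }
  assert (e := is_derive_unique _ _ _ (hW t ht)).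
  rewrite (is_derive_unique _ _ _ hHW) in e.
  (* Two values of one derivative are equated, and the nonzero factor [exp (B t)] is cancelled. *)
  apply Rmult_eq_reg_r in e; [| apply Rgt_not_eq, exp_pos].
  unfold pde_at; lra.
Qed.

(** No regularity is imposed on [a], so a point might lie on no characteristic; the equivalence on
    the whole plane therefore assumes that characteristics cover it. One fixed primitive [K]
    suffices, as [H] absorbs its constant. *)
Theorem proposition1
  (a alpha : R -> R -> R) (b B G K : R -> R) (u : R -> R -> R)
  (hB : forall t, is_derive B t (b t))
  (hK : forall v, is_derive K v (G v))
  (hu : of_class_C2 u) :
  (forall (lo hi : Rbar) (x0 : R) (x : R -> R),
     characteristic a lo hi x0 x ->
     ((forall t, between lo hi t -> pde_at a alpha b B G u (x t) t) <->
      reduced_along alpha B K lo hi x u)) /\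
  ((forall p s : R, exists (lo hi : Rbar) (x0 : R) (x : R -> R),
      characteristic a lo hi x0 x /\ between lo hi s /\ x s = p) ->
   ((forall p s : R, pde_at a alpha b B G u p s) <->
    (forall (lo hi : Rbar) (x0 : R) (x : R -> R),
       characteristic a lo hi x0 x -> reduced_along alpha B K lo hi x u))).
Proof.
assert (hcurve := fun lo hi x0 x => pde_along_iff_reduced a alpha b B G K u
  lo hi x0 x hB hK hu).
split; [exact hcurve |].
intros hcover; split.
- intros hpde lo hi x0 x hx; apply (hcurve lo hi x0 x hx); auto.
- intros hred p s.
  (* The equation at a point is read off on a characteristic through that point. *)
  destruct (hcover p s) as (lo & hi & x0 & x & hx & hs & <-).
  exact (proj2 (hcurve lo hi x0 x hx) (hred lo hi x0 x hx) s hs).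
Qed.
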